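(* Let $N\ge3$ and $\varphi,\vartheta\in\mathbb R$. Set $\varepsilon_N:=N\bmod 2\in\{0,1\}$, $\delta_N:=\frac{1-\varepsilon_N}{2}$, $\omega:=e^{2\pi i/N}$, and define $$\psi_k(j):=\frac1{\sqrt N}\exp\Bigl(\frac{\pi i j(j-\varepsilon_N)}N\Bigr)\omega^{jk},\qquad j,k\in\mathbb Z/N\mathbb Z .$$ Let $\widehat A_N(\varphi,\vartheta)$ be the matrix of $A_N(\varphi,\vartheta)$ in the orthonormal basis $(\psi_k)_{k\in\mathbb Z/N\mathbb Z}$ of $\mathbb C^N$, and set $\rho_{k,N}(\varphi,\vartheta):=\widehat A_N(\varphi,\vartheta)_{k+1,k}\,\widehat A_N(\varphi,\vartheta)_{k,k+1}$. Then $$\rho_{k,N}(\varphi,\vartheta)=\frac{e^{i\varphi}}2\Bigl(\cos\varphi+\cos\bigl(\tfrac{2\pi(k+\delta_N)}N-\vartheta\bigr)\Bigr).$$ Moreover, there is a monic polynomial $Q_{N,\varphi}(z)$, independent of $\vartheta$ (and of $\tau$), such that for every $\tau=e^{i\kappa}$ with $\kappa\in\mathbb R$, $$\chi^{\tau}_{N,\varphi,\vartheta}(z)=Q_{N,\varphi}(z)-2^{1-N}\cos(N\vartheta)-2^{1-N}e^{iN\varphi}\cos\kappa .$$ Hence $$\chi^{\tau}_{N,\varphi,\vartheta}(z)=\chi^{1}_{N,\varphi,0}(z)+2^{1-N}\bigl(1-\cos(N\vartheta)\bigr)+2^{1-N}e^{iN\varphi}\bigl(1-\cos\kappa\bigr),$$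 and thus all periodic matrices $A_N(\varphi,\vartheta)$ with $\vartheta\in\frac{2\pi}{N}\mathbb Z$ are isospectral, for every $N$. When $\varphi=\pi/2$ and $N$ is even, $$\chi^{i^N}_{N,\pi/2,\pi/2}(z)=\chi^{1}_{N,\pi/2,0}(z),$$ whereas when $\varphi=\pi/2$ and $N$ is odd, $$\chi^{i^N}_{N,\pi/2,\pi/2}(z)=Q_{N,\pi/2}(z).$$
   Context: Indices of $\mathbb C^N$ are in $\mathbb Z/N\mathbb Z$, represented by $0,\dots,N-1$, with standard basis $(e_j)$. For $|\tau|=1$ let $S_\tau$ be the twisted shift $S_\tau e_j=e_{j+1}$ for $0\le j<N-1$, $S_\tau e_{N-1}=\tau e_0$. Set $D_N(\vartheta)=\operatorname{diag}\bigl(\cos(\tfrac{2\pi j}{N}+\vartheta)\bigr)_{j\in\mathbb Z/N\mathbb Z}$, $$A_N^\tau(\varphi,\vartheta)=e^{i\varphi}\frac{S_\tau+S_\tau^{-1}}2+D_N(\vartheta),\qquad A_N(\varphi,\vartheta)=A_N^1(\varphi,\vartheta),$$ and $\chi^{\tau}_{N,\varphi,\vartheta}(z)=\det\bigl(zI-A_N^\tau(\varphi,\vartheta)\bigr)$. The superscript $\tau$ is the boundary twist, not a power. *)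

(* Defs.v *)
From HB Require Import structures.
From mathcomp Require Import all_boot all_order all_algebra.
From mathcomp Require Import reals trigo.
From mathcomp Require Import complex.

Set Implicit Arguments.
Unset Strict Implicit.
Unset Printing Implicit Defensive.

Import Order.TTheory GRing.Theory Num.Theory.

Open Scope ring_scope.
Open Scope complex_scope.

Section Definitions.
Variable R : realType.
Local Notation C := R[i].

(* e^{i x} for a real angle x *)
Definition expi (x : R) : C := cos x +i* sin x.

Section Matrices.
Variable N : nat.

(* Matrices act on column vectors: column j is the image of e_j. *)
Definition twisted_shift (tau : C) : 'M[C]_N :=
  \matrix_(i, j) if (j.+1 < N)%N then ((i : nat) == j.+1)%:R
                 else tau *+ ((i : nat) == 0%N).

Definition cosine_diag (theta : R) : 'M[C]_N :=
  diag_mx (\row_(j < N) (cos (2 * pi * j%:R / N%:R + theta))%:C).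

Definition twistedA (tau : C) (phi theta : R) : 'M[C]_N :=
  (expi phi / 2) *: (twisted_shift tau + invmx (twisted_shift tau))
  + cosine_diag theta.

Definition periodicA (phi theta : R) : 'M[C]_N := twistedA 1 phi theta.

Definition chi (tau : C) (phi theta : R) : {poly C} :=
  char_poly (twistedA tau phi theta).

Definition parity : nat := (N %% 2)%N.

Definition delta : R := (1 - parity%:R) / 2.

Definition omega : C := expi (2 * pi / N%:R).

Definition psi (k j : 'I_N) : C :=
  ((Num.sqrt N%:R)^-1)%:C
  * expi (pi * (j%:R * (j%:R - parity%:R)) / N%:R)
  * omega ^+ (j * k).

Definition orthonormal_family (v : 'I_N -> 'I_N -> C) : Prop :=
  forall k l, \sum_(j < N) v k j * (v l j)^* = (k == l)%:R.

Definition matrix_in_basis (v : 'I_N -> 'I_N -> C) (A : 'M[C]_N) : 'M[C]_N :=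
  let P := \matrix_(j, k) v k j in invmx P *m A *m P.

Definition hatA (phi theta : R) : 'M[C]_N :=
  matrix_in_basis psi (periodicA phi theta).

(* [ordS] is the cyclic successor k |-> k + 1 mod N on 'I_N. *)
Definition rho (phi theta : R) (k : 'I_N) : C :=
  hatA phi theta (ordS k) k * hatA phi theta k (ordS k).

(* Same eigenvalues, counted with algebraic multiplicity. *)
Definition isospectral (A B : 'M[C]_N) : Prop :=
  forall z : C, mup z (char_poly A) = mup z (char_poly B).

End Matrices.
End Definitions.

Arguments omega {R} N.
Arguments psi {R} N k j.
Arguments delta {R} N.

(* Main.v *)
(** The clock matrix [X = diag(omega^j)] and the twisted shift [Y] satisfy the
    finite Weyl relation [X Y = omega Y X].  If [M] commutes with [Y], then
    conjugation by [Y] shows that [det (M - b (u X + u^-1 X^-1))], a Laurent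
    polynomial in [u] with exponents between [-N] and [N], is invariant under
    [u |-> omega u]; only the exponents [-N, 0, N] survive, and the extreme
    coefficients are determinants of multiples of [X] and [X^-1].  With
    [u = e^(i theta)] this yields the dependence on [theta].  The
    dependence on the twist follows from the same relation with the two matrices
    exchanged, because a diagonal gauge turns the twisted shift by [e^(i kappa)]
    into [e^(i kappa / N)] times the untwisted shift.  Finally, in the basis
    [psi] the clock matrix becomes the shift and the inverse shift becomes the
    shift weighted by the phases [e^(2 pi i (k + delta) / N)]. *)

Require Import Defs.
From mathcomp Require Import all_boot all_order all_algebra perm.
From mathcomp Require Import reals trigo complex.
From mathcomp Require Import ring lra zify.

Set Implicit Arguments.
Unset Strict Implicit.
Unset Printing Implicit Defensive.

Import Order.TTheory GRing.Theory Num.Theory.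

(** * Generalities on polynomials, intertwined matrices and finite sums *)

Lemma poly_ext (F : numFieldType) (p q : {poly F}) :
  (forall x, p.[x] = q.[x]) -> p = q.
Proof.
move=> pq; apply/eqP; rewrite -subr_eq0; apply/negPn/negP => nz.
pose rs : seq F := [seq i%:R | i <- iota 0 (size (p - q))].
have rsroots : all (root (p - q)) rs.
  by apply/allP => x _; rewrite /root hornerD hornerN pq subrr.
have rsuniq : uniq rs.
  rewrite map_inj_uniq ?iota_uniq // => i j /eqP.
  by rewrite eqr_nat => /eqP.
by have := max_poly_roots nz rsroots rsuniq; rewrite size_map size_iota ltnn.
Qed.

(** In the top coefficient only the degree-2 term of the head paired with the top term of the tail
    survives. The degrees are formal: these coefficients may vanish. *)
Lemma size_coef_prod_le3 {R : comNzRingType} {I : Type} (r : seq I)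
    (F : I -> {poly R}) :
  (forall i, (size (F i) <= 3)%N) ->
  (size (\prod_(i <- r) F i)%R <= (size r).*2.+1)%N /\
  (\prod_(i <- r) F i)`_(size r).*2 = \prod_(i <- r) (F i)`_2.
Proof.
move=> sF; elim: r => [|i r [IHs IHc]].
  by rewrite !big_nil size_poly1 coef1.
rewrite !big_cons /=; split.
  apply: leq_trans (size_polyMleq _ _) _.
  have := leq_add (sF i) IHs; rewrite doubleS; case: (_ + _)%N => //= n.
rewrite coefM -IHc doubleS.
have lt2 : (2 < (size r).*2.+3)%N by [].
rewrite (bigD1 (Ordinal lt2)) //= subSS subSS subn0 [X in _ + X]big1 ?addr0 // => -[j ltj] /=.
rewrite -val_eqE /= => neq_j2.
case: (ltngtP j 2%N) neq_j2 => [jlt2 _|jgt2 _|->] //.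
  by rewrite [X in _ * X]nth_default ?mulr0 //; apply: leq_trans IHs _;
     case: j jlt2 {ltj} => [|[|]].
by rewrite nth_default ?mul0r //; apply: leq_trans (sF i) _.
Qed.

Lemma det_intertwine {R : comUnitRingType} {n} (X Y G : 'M[R]_n) :
  G \in unitmx -> X *m G = G *m Y -> \det X = \det Y.
Proof.
move=> uG /(congr1 determinant); rewrite !det_mulmx [RHS]mulrC.
by apply: mulIr; rewrite -unitmxE.
Qed.

Lemma invmx_intertwine {R : comUnitRingType} {m n} (X : 'M[R]_m) (Y : 'M[R]_n)
    (G : 'M[R]_(m, n)) :
  X \in unitmx -> Y \in unitmx -> X *m G = G *m Y ->
  invmx X *m G = G *m invmx Y.
Proof.
move=> uX uY XG.
by rewrite -[LHS](mulmxK uY) -[_ *m _ *m Y]mulmxA -XG mulKmx.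
Qed.

(** Besides the last term, each of the blocks of length [n] starting at 0 and at [n] keeps only its
    first term. *)
Lemma sum_multiples_le_double (V : zmodType) (n : nat) (a : nat -> V) :
  (0 < n)%N -> (forall i, ~~ (n %| i)%N -> a i = 0) ->
  \sum_(i < n.*2.+1) a i = a 0%N + a n + a n.*2.
Proof.
move=> n0 a0; rewrite big_ord_recr /=; congr (_ + _).
rewrite -(big_mkord xpredT) (big_cat_nat (n := n)) //= -?addnn ?leq_addr //.
have sum1 m : (forall i, (m < i < m + n)%N -> a i = 0) -> \sum_(m <= i < m + n) a i = a m.
  move=> am; rewrite big_ltn; last by rewrite -{1}[m]addn0 ltn_add2l.
  rewrite big_nat_cond big1 ?addr0 // => i; rewrite andbT; exact: am.
rewrite -[X in \sum_(0 <= i < X) _]add0n !sum1 // => i /andP[mi in_]; apply: a0.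
  by rewrite -(subnKC (ltnW mi)) dvdn_addr // gtnNdvd ?subn_gt0 // ltn_subLR // ltnW.
by rewrite gtnNdvd.
Qed.

(** * Determinants of quadratic matrix pencils *)

Section QuadraticPencil.
Variables (F : numFieldType) (n : nat) (M0 M1 M2 : 'M[F]_n).

Definition pencil : 'M[{poly F}]_n :=
  \matrix_(i, j) ((M0 i j)%:P + (M1 i j)%:P * 'X + (M2 i j)%:P * 'X^2).

Lemma horner_det_pencil u :
  (\det pencil).[u] = \det (M0 + u *: M1 + u ^+ 2 *: M2).
Proof.
rewrite -horner_evalE -det_map_mx; congr (\det _); apply/matrixP => i j.
by rewrite !mxE /= /horner_eval !hornerE /=; ring.
Qed.

Lemma size_pencil i j : (size (pencil i j) <= 3)%N.
Proof.
by apply/leq_sizeP=> k k3; rewrite mxE !coefE; case: k k3 => [|[|[|k]]] //= _;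
   rewrite !mulr0 ?addr0.
Qed.

Lemma coef2_pencil i j : (pencil i j)`_2 = M2 i j.
Proof. by rewrite mxE !coefE /= mulr0 mulr1 !add0r. Qed.

Lemma size_coef_pencil_prod (s : 'S_n) :
  (size (\prod_i pencil i (s i))%R <= n.*2.+1)%N /\
  (\prod_i pencil i (s i))`_(n.*2) = \prod_i M2 i (s i).
Proof.
have [] := size_coef_prod_le3 (index_enum 'I_n) (fun i => size_pencil i (s i)).
have -> : size (index_enum 'I_n) = n by rewrite /index_enum -enumT size_enum_ord.
by rewrite (eq_bigr (fun i => M2 i (s i))) // => i _; apply: coef2_pencil.
Qed.

Lemma size_det_pencil : (size (\det pencil) <= n.*2.+1)%N.
Proof.
apply/leq_sizeP=> k kn; rewrite coef_sum big1 // => s _.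
have [sz _] := size_coef_pencil_prod s.
by rewrite mulr_sign; case: ifP => _; rewrite ?coefN nth_default ?oppr0 //;
   apply: leq_trans sz kn.
Qed.

Lemma lead_det_pencil : (\det pencil)`_(n.*2) = \det M2.
Proof.
rewrite coef_sum; apply: eq_bigr => s _; have [_ <-] := size_coef_pencil_prod s.
by rewrite !mulr_sign; case: ifP => _; rewrite ?coefN.
Qed.

(** Conjugation by [Y] gives the three coefficients weights [w^-1], 1, [w], so it turns the pencil
    at [u] into [w^-1] times the pencil at [w u]. The scalar drops out of the determinant because
    [w^n = 1]. *)
Lemma det_pencil_roots_of_unity (w : F) (Y : 'M[F]_n) :
  (0 < n)%N -> n.-primitive_root w -> Y \in unitmx ->
  M0 *m Y = w^-1 *: (Y *m M0) -> M1 *m Y = Y *m M1 -> M2 *m Y = w *: (Y *m M2) ->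
  exists c, forall u,
    \det (M0 + u *: M1 + u ^+ 2 *: M2)
      = \det M0 + c * u ^+ n + \det M2 * (u ^+ n) ^+ 2.
Proof.
move=> n0 wprim uY Y0 Y1 Y2; have w0 : w != 0 by rewrite (prim_root_eq0 wprim) -lt0n.
have inv u : (\det pencil).[w * u] = (\det pencil).[u].
  rewrite !horner_det_pencil.
  have /(det_intertwine uY) -> : (M0 + u *: M1 + u ^+ 2 *: M2) *m Y
      = Y *m (w^-1 *: (M0 + (w * u) *: M1 + (w * u) ^+ 2 *: M2)).
    rewrite !mulmxDl -!scalemxAl Y0 Y1 Y2 !scalerDr !scalerA !mulmxDr -!scalemxAr.
    by rewrite mulKf // (_ : w^-1 * (w * u) ^+ 2 = u ^+ 2 * w) //; field.
  by rewrite detZ exprVn (prim_expr_order wprim) invr1 mul1r.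
have coef0 i : ~~ (n %| i)%N -> (\det pencil)`_i = 0.
  (* [q] is the determinant with [u] rescaled to [w u]; comparing coefficients gives
     [(w^i - 1) a_i = 0]. *)
  pose q := \poly_(i < size (\det pencil)) (w ^+ i * (\det pencil)`_i).
  have /polyP/(_ i) : q = \det pencil.
    apply: poly_ext => u; rewrite -inv horner_poly horner_coef.
    by apply: eq_bigr => j _; rewrite exprMn mulrCA mulrA.
  rewrite coef_poly (prim_order_dvd wprim) => E nw.
  case: ltnP E => [_|/leq_sizeP-> //].
  move/eqP; rewrite -[eqbRHS]mul1r -subr_eq0 -mulrBl mulf_eq0 subr_eq0.
  by rewrite (negbTE nw) => /eqP.
exists (\det pencil)`_n => u; rewrite -horner_det_pencil.
rewrite (horner_coef_wide u size_det_pencil) -lead_det_pencil.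
have -> : \det M0 = (\det pencil)`_0.
  by rewrite -horner_coef0 horner_det_pencil expr0n !scale0r !addr0.
rewrite (@sum_multiples_le_double _ _ (fun i => (\det pencil)`_i * u ^+ i)) // => [|i /coef0->].
  by rewrite expr0 mulr1 -exprM muln2.
by rewrite mul0r.
Qed.

End QuadraticPencil.

(** * Determinants built from a Weyl pair *)

Section Weyl.
Variables (F : numFieldType) (n : nat) (w : F) (X Y : 'M[F]_n).
Hypotheses (n0 : (0 < n)%N) (wprim : n.-primitive_root w).
Hypotheses (uX : X \in unitmx) (uY : Y \in unitmx).
Hypothesis weylXY : X *m Y = w *: (Y *m X).

Lemma weyl_invmx : invmx X *m Y = w^-1 *: (Y *m invmx X).
Proof.
have w0 : w != 0 by rewrite (prim_root_eq0 wprim) -lt0n.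
have uwX : w *: X \in unitmx.
  by rewrite unitmxE detZ unitrM unitrX ?unitfE //= -unitfE -unitmxE.
by rewrite (invmx_intertwine (Y := w *: X)) -?scalemxAr // invmxZ // scalemxAr.
Qed.

(** Multiplying by [u] turns the Laurent expression into a quadratic pencil. The prescribed [\det X]
    is a sign, equal to its own inverse, so both outer determinants are [- b^n]. *)
Lemma det_weyl_pencil (M : 'M[F]_n) (b : F) :
  M *m Y = Y *m M -> \det X = - (-1) ^+ n ->
  exists c, forall u, u != 0 ->
    \det (M - b *: (u *: X + u^-1 *: invmx X)) = c - b ^+ n * (u ^+ n + u^-1 ^+ n).
Proof.
move=> MY dX.
have [|||c E] := det_pencil_roots_of_unity (M0 := - b *: invmx X) (M1 := M)
    (M2 := - b *: X) n0 wprim uY.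
- by rewrite -scalemxAl weyl_invmx -scalemxAr !scalerA mulrC.
- exact: MY.
- by rewrite -scalemxAl weylXY -scalemxAr !scalerA mulrC.
exists c => u u0; have un0 : u ^+ n != 0 by rewrite expf_neq0.
apply: (mulfI un0); rewrite -detZ exprVn.
have dXV : (- b) ^+ n * (\det X)^-1 = - b ^+ n.
  by rewrite dX invrN -exprVn invrN invr1 mulrN -exprMn mulrN1 opprK.
have dXM : (- b) ^+ n * \det X = - b ^+ n.
  by rewrite dX mulrN -exprMn mulrN1 opprK.
rewrite (_ : u *: _ = - b *: invmx X + u *: M + u ^+ 2 *: (- b *: X)).
  by rewrite E !detZ det_inv dXV dXM; field.
by move: (invmx X) => X'; apply/matrixP => i j; rewrite !mxE; field.
Qed.

End Weyl.

Lemma horner_char_poly {R : comNzRingType} n (A : 'M[R]_n) z :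
  (char_poly A).[z] = \det (z%:M - A).
Proof.
rewrite -horner_evalE -det_map_mx; congr (\det _); apply/matrixP => i j.
by rewrite !mxE /= /horner_eval !hornerE; case: (i == j); rewrite ?mulr1n ?mulr0n !hornerE.
Qed.

Lemma invmx_unique {R : comUnitRingType} n (A B : 'M[R]_n) : A *m B = 1%:M -> invmx A = B.
Proof. by move=> AB; have [uA _] := mulmx1_unit AB; rewrite -[RHS](mulKmx uA) AB mulmx1. Qed.

(** * Clock matrices: inverse and determinant *)

Section Clock.
Variables (F : fieldType) (n : nat).

Definition clock (v : F) : 'M[F]_n := diag_mx (\row_(j < n) v ^+ j).

Lemma mul_clockV v : v != 0 -> clock v *m clock v^-1 = 1%:M.
Proof.
move=> v0; rewrite mulmx_diag -diag_const_mx; congr diag_mx; apply/rowP => j.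
by rewrite !mxE -exprMn mulfV // expr1n.
Qed.

Lemma unitmx_clock v : v != 0 -> clock v \in unitmx.
Proof. by move=> /mul_clockV/mulmx1_unit[]. Qed.

Lemma invmx_clock v : v != 0 -> invmx (clock v) = clock v^-1.
Proof. by move=> /mul_clockV/invmx_unique. Qed.

(** Compare constant terms in [X^n - 1 = \prod_j (X - v^j)]. *)
Lemma det_clock_prim v : (0 < n)%N -> n.-primitive_root v -> \det (clock v) = - (-1) ^+ n.
Proof.
move=> n0 /factor_Xn_sub_1/(congr1 (fun p => p.[0])).
rewrite big_mkord horner_prod hornerD hornerN hornerXn hornerC expr0n gtn_eqF // sub0r.
under eq_bigr => j _ do rewrite hornerXsubC sub0r -mulN1r.
rewrite big_split prodr_const card_ord /= => /(congr1 ( *%R ((-1) ^+ n))).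
rewrite mulrN1 signrMK => <-.
by rewrite det_diag; apply: eq_bigr => j _; rewrite mxE.
Qed.

End Clock.

(** * Twisted shifts and their exchange with clock matrices *)

Section Shift.
Variables (R : realType) (N : nat).
Local Notation C := R[i].

(** The first row contains only [tau], in the last column, and its minor is an identity matrix. *)
Lemma det_twisted_shift (tau : C) :
  (0 < N)%N -> \det (twisted_shift N tau) = - (-1) ^+ N * tau.
Proof.
case: N => // n _; rewrite (expand_det_row _ ord0) (bigD1 ord_max) //= big1 => [|j jmax].
  rewrite addr0 mxE /= ltnn mulr1n mulrC /cofactor (_ : row' _ _ = 1%:M) ?det1 ?mulr1.
    by rewrite add0n exprS mulN1r opprK.
  apply/matrixP => i j; rewrite !mxE lift0 lift_max ltnS ltn_ord eqSS.
  by rewrite -val_eqE.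
by rewrite mxE ltnS ltn_neqAle -ltnS ltn_ord andbT jmax mul0r.
Qed.

Lemma unitmx_twisted_shift (tau : C) :
  (0 < N)%N -> tau != 0 -> twisted_shift N tau \in unitmx.
Proof.
by move=> N0 t0; rewrite unitmxE det_twisted_shift // unitfE mulf_neq0 ?oppr_eq0 ?signr_eq0.
Qed.

(* [v = omega] gives the Weyl relation; [tau = v^-N] gives the gauge change that
   trades the boundary twist for a uniform phase. *)
Lemma clock_twisted_shift (v tau : C) :
  clock N v *m twisted_shift N (v ^+ N * tau) = v *: (twisted_shift N tau *m clock N v).
Proof.
apply/matrixP => i j; rewrite mul_diag_mx mul_mx_diag !mxE.
case: ltnP => [jN|Nj].
  by case: eqP => [->|]; rewrite ?mulr0 ?mul0r ?mulr0 // mulr1 mul1r exprS.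
case: eqP => [->|]; rewrite ?mulr0n ?mulr0 ?mul0r ?mulr0 // !mulr1n expr0 mul1r.
by rewrite mulrCA -exprS mulrC; congr (_ * _ ^+ _); apply/eqP; rewrite eqn_leq ltn_ord Nj.
Qed.

End Shift.

(** * Unit complex numbers and the primitive root [omega] *)

Section Expi.
Variable R : realType.
Implicit Types x y : R.

Lemma expi0 : expi 0 = 1 :> R[i].
Proof. by rewrite /expi cos0 sin0. Qed.

Lemma expiD x y : expi (x + y) = expi x * expi y.
Proof. by rewrite /expi cosD sinD; congr Complex; rewrite addrC mulrC [X in _ + X]mulrC. Qed.

Lemma expi_neq0 x : expi x != 0.
Proof.
apply/eqP => x0; have := expiD x (- x).
by rewrite subrr expi0 x0 mul0r => /eqP; rewrite oner_eq0.
Qed.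

Lemma expiN x : expi (- x) = (expi x)^-1.
Proof. by apply: (mulfI (expi_neq0 x)); rewrite -expiD subrr expi0 mulfV ?expi_neq0. Qed.

Lemma expiX x n : expi x ^+ n = expi (n%:R * x).
Proof.
by elim: n => [|n IHn]; rewrite ?mul0r ?expi0 // exprS IHn -expiD -natr1 mulrDl mul1r addrC.
Qed.

Lemma conj_expi x : (expi x)^*%C = (expi x)^-1.
Proof. by rewrite -expiN /expi cosN sinN. Qed.

Lemma cos_expi x : (cos x)%:C = (expi x + (expi x)^-1) / 2.
Proof.
rewrite -expiN; apply: (mulIf (x := 2)); first by rewrite pnatr_eq0.
rewrite divfK ?pnatr_eq0 // mulr_natr mulr2n /expi cosN sinN.
by rewrite -rmorphD; congr Complex; rewrite subrr.
Qed.

Lemma expi_pi : expi pi = -1 :> R[i].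
Proof. by rewrite /expi cospi sinpi; congr Complex; rewrite oppr0. Qed.

Lemma cos_sin_natpi n : cos (n%:R * pi) = (-1) ^+ n :> R /\ sin (n%:R * pi) = 0 :> R.
Proof.
have : expi (n%:R * pi) = ((-1) ^+ n)%:C :> R[i].
  by rewrite -expiX expi_pi rmorphXn rmorphN rmorph1.
by case=> -> ->.
Qed.

Lemma expi_2pi n : expi (2 * pi * n%:R) = 1 :> R[i].
Proof. by rewrite mulrC -expiX mulrDl mul1r expiD expi_pi mulrNN mulr1 expr1n. Qed.

Lemma expi_neq1 x : 0 < x < 2 * pi -> expi x != 1.
Proof.
move=> /andP[x0 x2pi]; apply/eqP => -[cx _].
have s0 : 0 < sin (x / 2) by apply: sin_gt0_pi; apply/andP; split; lra.
have := cos_mulr2n (x / 2); rewrite (_ : x / 2 *+ 2 = x); last by field.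
by rewrite cos2sin2 cx; nra.
Qed.

Lemma expi_pihalf : expi (pi / 2) = 'i%C :> R[i].
Proof. by rewrite /expi cos_pihalf sin_pihalf. Qed.

(** The order [m] of [omega] divides [N]; if [m < N], the angle [2 pi m / N] lies strictly between 0
    and [2 pi], which excludes [omega^m = 1]. *)
Lemma omega_prim N : (0 < N)%N -> N.-primitive_root (omega N : R[i]).
Proof.
move=> N0; have N0R : N%:R != 0 :> R by rewrite pnatr_eq0 -lt0n.
have omegaN : omega N ^+ N = 1 :> R[i].
  by rewrite /omega expiX mulrC divfK // -[2 * pi]mulr1 (expi_2pi 1).
have [m mprim mN] := prim_order_exists N0 omegaN.
have m0 : (0 < m)%N := prim_order_gt0 mprim.
have := dvdn_leq N0 mN; rewrite leq_eqVlt => /predU1P[mE|ltmN].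
  by rewrite mE in mprim.
have /eqP[] : omega N ^+ m != 1 :> R[i].
  rewrite /omega expiX mulrCA; apply: expi_neq1.
  rewrite !mulr_gt0 ?invr_gt0 ?ltr0n ?pi_gt0 //=.
  rewrite gtr_pMr ?mulr_gt0 ?pi_gt0 ?ltr0n //.
  by rewrite ltr_pdivrMr ?ltr0n // mul1r ltr_nat.
exact: prim_expr_order.
Qed.

End Expi.

Lemma exprz_1Bn {F : fieldType} (x : F) (n : nat) :
  x != 0 -> x ^ (1 - n%:Z) = x * x^-1 ^+ n.
Proof. by move=> x0; rewrite expfzDr // expr1z exprVn exprnN. Qed.

(** * Dependence of the characteristic polynomial on [theta] and the twist *)

Section Chi.
Variables (R : realType) (N : nat).
Hypothesis N0 : (0 < N)%N.
Local Notation C := R[i].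
Local Notation w := (omega N : C).

Let w0 : w != 0. Proof. exact: expi_neq0. Qed.
Let wprim := omega_prim R N0.

Lemma cosine_diag_clock (theta : R) :
  cosine_diag N theta
    = 2^-1 *: (expi theta *: clock N w + (expi theta)^-1 *: invmx (clock N w)).
Proof.
rewrite invmx_clock // /clock -!linearZ -!linearD -linearZ; congr diag_mx.
apply/rowP => j; rewrite !mxE cos_expi expiD.
have -> : expi (2 * pi * j%:R / N%:R) = w ^+ j.
  by rewrite /omega expiX; congr expi; ring.
rewrite invfM exprVn; ring.
Qed.

Lemma cosine_diag_clockC (theta : R) (v : C) :
  cosine_diag N theta *m clock N v = clock N v *m cosine_diag N theta.
Proof. exact: diag_mxC. Qed.

(** Weyl pencil with [X] the clock matrix, [b = 1/2] and [u = expi theta]; the hopping term commutes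
    with the shift. *)
Lemma det_chi_theta (tau a z : C) :
  tau != 0 ->
  let A := a *: (twisted_shift N tau + invmx (twisted_shift N tau)) in
  exists c, forall theta : R,
    \det (z%:M - (A + cosine_diag N theta))
      = c - 2 * (2^-1) ^+ N * (cos (N%:R * theta))%:C.
Proof.
move=> t0 A; have uS := unitmx_twisted_shift N0 t0.
have [|||c E] := det_weyl_pencil (X := clock N w) (Y := twisted_shift N tau) N0 wprim
    (unitmx_clock N w0) uS _ (M := z%:M - A) 2^-1.
- by rewrite -clock_twisted_shift (prim_expr_order wprim) mul1r.
- rewrite mulmxBl mulmxBr scalar_mxC -scalemxAl -scalemxAr mulmxDl mulmxDr.
  by rewrite mulmxV // mulVmx.
- exact: det_clock_prim.
exists c => theta; rewrite opprD addrA cosine_diag_clock E ?expi_neq0 // cos_expi.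
by rewrite -expiX exprVn; field; rewrite expf_neq0 ?expi_neq0 ?pnatr_eq0.
Qed.

(** Now the shift is [X], and the cosine diagonal commutes with the clock matrix. After the gauge
    change the twist survives only as [u = expi (kappa / N)]. *)
Lemma det_chi_kappa (phi theta : R) (z : C) :
  exists c, forall kappa : R,
    \det (z%:M - twistedA N (expi kappa) phi theta)
      = c - 2 * (2^-1) ^+ N * expi (N%:R * phi) * (cos kappa)%:C.
Proof.
set S := twisted_shift N (1 : C).
have uS : S \in unitmx by rewrite unitmx_twisted_shift ?oner_eq0.
have [|||c E] := det_weyl_pencil (X := S) (Y := clock N w^-1) N0 wprim
    uS (unitmx_clock N (invr_neq0 w0)) _ (M := z%:M - cosine_diag N theta) (expi phi / 2).
(* Exchanging the two matrices inverts the root, hence the clock matrix at [w^-1]. *)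
- have := clock_twisted_shift N w^-1 1.
  rewrite mulr1 exprVn (prim_expr_order wprim) invr1 -/S => ->.
  by rewrite scalerA mulfV // scale1r.
- by rewrite mulmxBl mulmxBr scalar_mxC cosine_diag_clockC.
- by rewrite det_twisted_shift // mulr1.
exists c => kappa; set T := twisted_shift N (expi kappa).
pose v := expi (kappa / N%:R); have v0 : v != 0 := expi_neq0 _.
have vN : v ^+ N = expi kappa.
  by rewrite /v expiX mulrCA mulfV ?mulr1 // pnatr_eq0 -lt0n.
have uT : T \in unitmx by rewrite unitmx_twisted_shift ?expi_neq0.
have uG : clock N v^-1 \in unitmx by rewrite unitmx_clock ?invr_neq0.
have TG : T *m clock N v^-1 = clock N v^-1 *m (v *: S).
  have := clock_twisted_shift N v^-1 (expi kappa).
  rewrite exprVn vN mulVf ?expi_neq0 // -/S -scalemxAr => ->.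
  by rewrite scalerA mulfV // scale1r.
have uvS : v *: S \in unitmx.
  by rewrite unitmxE detZ unitrM unitrX ?unitfE //= -unitfE -unitmxE.
have TVG := invmx_intertwine uT uvS TG.
rewrite (@det_intertwine _ _ _ (z%:M - cosine_diag N theta
    - (expi phi / 2) *: (v *: S + v^-1 *: invmx S)) _ uG).
  rewrite E // vN cos_expi exprMn exprVn vN expiX.
  by field; rewrite ?expi_neq0 ?pnatr_eq0.
rewrite /twistedA [_ + cosine_diag N theta]addrC opprD addrA mulmxBl [RHS]mulmxBr.
rewrite -/T -scalemxAl -scalemxAr [(T + _) *m _]mulmxDl TG TVG invmxZ // -mulmxDr.
by rewrite mulmxBl mulmxBr scalar_mxC cosine_diag_clockC.
Qed.

(** First [theta] moves to 0 at fixed twist, then [kappa] moves to 0 at [theta = 0]; the unknown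
    constants cancel. *)
Lemma chi_formula (phi theta kappa : R) :
  chi N (expi kappa) phi theta =
    chi N 1 phi 0
    + (2 ^ (1 - N%:Z) * (1 - cos (N%:R * theta))%:C)%:P
    + (2 ^ (1 - N%:Z) * expi (N%:R * phi) * (1 - cos kappa)%:C)%:P.
Proof.
apply: poly_ext => z; rewrite !hornerD !hornerC !horner_char_poly exprz_1Bn ?pnatr_eq0 //.
have [c Ec] := det_chi_theta (expi phi / 2) z (expi_neq0 kappa).
have [d Ed] := det_chi_kappa phi 0 z.
have oneC : (1 : R)%:C = 1 by [].
have sub1C (x : R) : (1 - x)%:C = 1 - x%:C by rewrite rmorphB.
rewrite (Ec theta) -[X in _ = \det (_ - twistedA _ X _ _) + _ + _]expi0 (Ed 0) cos0.
have := Ed kappa; rewrite /twistedA Ec mulr0 cos0 !sub1C oneC => /(canRL (subrK _)) ->.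
by ring.
Qed.

End Chi.

(** * The basis [psi] and the matrix of the operator in it *)

Section FourierGaussBasis.
Variables (R : realType) (N : nat).
Hypothesis N0 : (0 < N)%N.
Local Notation C := R[i].
Local Notation w := (omega N : C).
Local Notation S := (twisted_shift N (1 : C)).

Let w0 : w != 0. Proof. exact: expi_neq0. Qed.
Let wprim := omega_prim R N0.
Let N0R : N%:R != 0 :> R. Proof. by rewrite pnatr_eq0 -lt0n. Qed.
Let uS : S \in unitmx. Proof. by rewrite unitmx_twisted_shift ?oner_eq0. Qed.

Lemma shift1E i j : S i j = (i == ordS j)%:R.
Proof.
rewrite mxE -val_eqE /=; case: ltnP => jN; first by rewrite modn_small.
have -> : j.+1 = N by apply/eqP; rewrite eqn_leq ltn_ord jN.
by rewrite modnn mulrb; case: eqP.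
Qed.

Lemma mulmx_shift1 (P : 'M[C]_N) i j : (P *m S) i j = P i (ordS j).
Proof.
rewrite mxE (bigD1 (ordS j)) //= shift1E eqxx mulr1 big1 ?addr0 // => l lj.
by rewrite shift1E (negbTE lj) mulr0.
Qed.

Lemma tr_shift1_mulmx (P : 'M[C]_N) i j : (S^T *m P) i j = P (ordS i) j.
Proof. by rewrite -[S^T *m P]trmxK trmx_mul trmxK mxE mulmx_shift1 mxE. Qed.

Lemma invmx_shift1 : invmx S = S^T.
Proof.
have SS : S^T *m S = 1%:M.
  apply/matrixP => i j; rewrite tr_shift1_mulmx shift1E mxE.
  by rewrite (inj_eq (can_inj (@ordSK N))).
by rewrite -[RHS](mulmxK uS) SS mul1mx.
Qed.

Let conjcM (x y : C) : (x * y)^*%C = x^*%C * y^*%C. Proof. exact: rmorphM. Qed.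
Let conjcXn (x : C) m : (x ^+ m)^*%C = x^*%C ^+ m. Proof. exact: rmorphXn. Qed.

(** The quadratic phases cancel, leaving a geometric sum of ratio [q = w^(k-l)], where [q^N = 1] and
    [q] differs from 1 unless [k = l]. *)
Lemma psi_orthonormal : orthonormal_family (@psi R N).
Proof.
move=> k l; pose q : C := w ^+ k / w ^+ l.
have term j : psi N k j * Num.conj (psi N l j) = N%:R^-1 * q ^+ j.
  rewrite -[Num.conj _]/((psi N l j)^*%C).
  rewrite /psi !conjcM conjcXn conj_expi conjc_real {2}/omega conj_expi -/(omega N).
  have -> : (N%:R^-1 : C) = ((Num.sqrt N%:R)^-1)%:C * ((Num.sqrt N%:R)^-1)%:C.
    by rewrite -rmorphM -expr2 exprVn sqr_sqrtr ?ler0n // fmorphV rmorph_nat.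
  rewrite /q expr_div_n exprVn -!exprM -![(_ * j)%N]mulnC.
  by move: (_^-1)%:C => s; field; rewrite expi_neq0 expf_neq0.
under eq_bigr => j _ do rewrite term.
rewrite -mulr_sumr; have [kl|kl] := eqVneq k l.
  under eq_bigr => j _ do rewrite /q kl divff ?expf_neq0 // expr1n.
  by rewrite sumr_const card_ord mulVf // pnatr_eq0 -lt0n.
have q1 : q - 1 != 0.
  rewrite subr_eq0 -(inj_eq (mulIf (expf_neq0 l w0))) mul1r divfK ?expf_neq0 //.
  by rewrite (eq_prim_root_expr wprim) !modn_small ?ltn_ord.
apply: (mulfI q1); rewrite mulrCA -subrX1 /q expr_div_n -!exprM ![(_ * N)%N]mulnC !exprM.
by rewrite (prim_expr_order wprim) !expr1n divr1 subrr !mulr0.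
Qed.

Let P : 'M[C]_N := \matrix_(j, k) psi N k j.

Lemma unitmx_psi : P \in unitmx.
Proof.
have /mulmx1_unit[] : P^T *m map_mx Num.conj P = 1%:M.
  apply/matrixP => k l; rewrite !mxE -psi_orthonormal.
  by apply: eq_bigr => j _; rewrite !mxE.
by rewrite unitmx_tr.
Qed.

Lemma clock_mul_psi : clock N w *m P = P *m S.
Proof.
apply/matrixP => j k; rewrite mulmx_shift1 mul_diag_mx !mxE /psi.
rewrite ![(j * _)%N]mulnC !exprM (prim_expr_mod wprim) exprS exprMn; ring.
Qed.

(** The increment [(j+1)(j+1-parity) - j(j-parity) = 2(j+delta)] supplies the factor [w^j] that
    raises the label [k], and the shift by [delta] in the phase. *)
Lemma psi_ordS (k j : 'I_N) :
  psi N k (ordS j) = expi (2 * pi * (k%:R + delta N) / N%:R) * psi N (ordS k) j :> C.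
Proof.
pose g (m : nat) : C := expi (pi * (m%:R * (m%:R - (parity N)%:R)) / N%:R) * w ^+ (m * k).
(* Wrap-around: [N - parity N] is even, so the quadratic phase at [N] is 1. *)
have gN : g N = g 0%N.
  rewrite /g mul0n mul0r mulr0 mul0r expi0 mul1r exprM (prim_expr_order wprim) expr1n mulr1.
  have -> : pi * (N%:R * (N%:R - (parity N)%:R)) / N%:R = 2 * pi * N./2%:R :> R.
    rewrite /parity modn2 -{2}(odd_double_half N) natrD -muln2 natrM.
    by field.
  exact: expi_2pi.
have -> : psi N k (ordS j) = ((Num.sqrt N%:R)^-1)%:C * g j.+1.
  rewrite /psi -mulrA; congr (_ * _); rewrite -[LHS]/(g (j.+1 %% N)%N).
  case: (ltnP j.+1 N) => jN; first by rewrite modn_small.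
  by rewrite (_ : j.+1 = N) ?modnn ?gN //; apply/eqP; rewrite eqn_leq ltn_ord jN.
rewrite /psi [(j * _)%N]mulnC exprM (prim_expr_mod wprim) -exprM.
rewrite -[_%:C * _ * _]mulrA [RHS]mulrCA /g; congr (_ * _); rewrite /omega !expiX -!expiD.
by congr expi; rewrite /delta !natrM -!natr1; field.
Qed.

Let beta (k : 'I_N) : C := expi (2 * pi * (k%:R + delta N) / N%:R).
Let Beta : 'M[C]_N := diag_mx (\row_k beta k).

Lemma shiftV_mul_psi : invmx S *m P = P *m (S *m Beta).
Proof.
apply/matrixP => j k; rewrite invmx_shift1 tr_shift1_mulmx mulmxA mul_mx_diag.
by rewrite [RHS]mxE mulmx_shift1 !mxE psi_ordS mulrC.
Qed.

Lemma hatAE (phi theta : R) :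
  hatA N phi theta
    = (expi phi / 2) *: (invmx Beta *m S^T + S *m Beta)
      + 2^-1 *: (expi theta *: S + (expi theta)^-1 *: S^T).
Proof.
have uP := unitmx_psi; have uBeta : Beta \in unitmx.
  rewrite unitmxE det_diag unitfE; apply/prodf_neq0 => k _.
  by rewrite mxE expi_neq0.
have uSB : S *m Beta \in unitmx by rewrite unitmx_mul uS.
have SP : S *m P = P *m (invmx Beta *m S^T).
  have := invmx_intertwine _ uSB shiftV_mul_psi; rewrite unitmx_inv invmxK => -> //.
  rewrite -invmx_shift1; congr (_ *m _); apply: invmx_unique.
  by rewrite mulmxA mulmxK // mulmxV.
have clockVP := invmx_intertwine (unitmx_clock N w0) uS clock_mul_psi.
rewrite /hatA /matrix_in_basis -/P -mulmxA /periodicA /twistedA cosine_diag_clock.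
apply: (canLR (mulKmx uP)).
rewrite mulmxDl mulmxDr -!scalemxAl -!scalemxAr; congr (_ *: _ + _ *: _).
  by rewrite mulmxDl mulmxDr SP shiftV_mul_psi.
by rewrite mulmxDl mulmxDr -!scalemxAl -!scalemxAr clock_mul_psi clockVP invmx_shift1.
Qed.

Lemma rhoE (phi theta : R) (k : 'I_N) :
  (2 < N)%N ->
  rho phi theta k =
    expi phi / 2 *
    (cos phi + cos (2 * pi * (k%:R + delta N) / N%:R - theta))%:C.
Proof.
move=> N3.
have invBeta : invmx Beta = diag_mx (\row_k (beta k)^-1).
  apply: invmx_unique; rewrite mulmx_diag -diag_const_mx; congr diag_mx.
  by apply/rowP => j; rewrite !mxE mulfV ?expi_neq0.
(* Here [N >= 3] matters: for [N = 2] the indices [k] and [k + 2] coincide, and both shifts would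
   contribute to each entry. *)
have kS : (k == ordS (ordS k)) = false.
  rewrite -val_eqE /= -[X in (X %% N)%N]addn1 modnDml addn1; have kN := ltn_ord k.
  case: (ltnP k.+2 N) => [kN2|Nk]; first by rewrite modn_small //; apply/eqP; lia.
  rewrite -(subnK Nk) modnDr modn_small; last by lia.
  by apply/eqP; lia.
have S1 : S (ordS k) k = 1 by rewrite shift1E eqxx.
have S0 : S k (ordS k) = 0 by rewrite shift1E kS.
(* Abstracting the shift keeps [mxE] from unfolding its entries. *)
rewrite /rho hatAE invBeta mul_diag_mx mul_mx_diag; move: (S) S1 S0 => T T1 T0.
rewrite !mxE T1 T0 !mulr0 !mulr1 !addr0 !add0r.
rewrite rmorphD /= !cos_expi expiD expiN -/(beta k).
by field; rewrite ?expi_neq0 ?pnatr_eq0.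
Qed.

End FourierGaussBasis.

Theorem theorem1p2 (R : realType) (N : nat) (hN : (3 <= N)%N) :
  orthonormal_family (@psi R N) /\
  (forall (phi theta : R) (k : 'I_N),
     rho phi theta k =
       expi phi / 2 *
       (cos phi + cos (2 * pi * (k%:R + delta N) / N%:R - theta))%:C) /\
  exists Q : R -> {poly R[i]},
    (forall phi : R, Q phi \is monic) /\
    (forall phi theta kappa : R,
       chi N (expi kappa) phi theta =
         Q phi
         - (2 ^ (1 - N%:Z) * (cos (N%:R * theta))%:C)%:P
         - (2 ^ (1 - N%:Z) * expi (N%:R * phi) * (cos kappa)%:C)%:P) /\
    (forall phi theta kappa : R,
       chi N (expi kappa) phi theta =
         chi N 1 phi 0
         + (2 ^ (1 - N%:Z) * (1 - cos (N%:R * theta))%:C)%:P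
         + (2 ^ (1 - N%:Z) * expi (N%:R * phi) * (1 - cos kappa)%:C)%:P) /\
    (forall (phi : R) (m m' : int),
       isospectral (periodicA N phi (2 * pi / N%:R * m%:~R))
                   (periodicA N phi (2 * pi / N%:R * m'%:~R))) /\
    (~~ odd N ->
       chi N ('i%C ^+ N) (pi / 2) (pi / 2) = chi N 1 (pi / 2) (0 : R)) /\
    (odd N ->
       chi N ('i%C ^+ N) (pi / 2) (pi / 2) = Q (pi / 2)).
Proof.
have N0 : (0 < N)%N by apply: leq_trans hN.
have N0R : N%:R != 0 :> R by rewrite pnatr_eq0 -lt0n.
split; first exact: psi_orthonormal.
split; first by move=> phi theta k; apply: rhoE.
(* At [theta = kappa = 0] both cosines are 1, so adding back the two cosine terms isolates [Q]. *)
pose Q (phi : R) : {poly R[i]} := chi N 1 phi 0 + (2 ^ (1 - N%:Z))%:P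
  + (2 ^ (1 - N%:Z) * expi (N%:R * phi))%:P.
have sub1C (x : R) : (1 - x)%:C = 1 - x%:C by rewrite rmorphB.
have chiQ phi theta kappa : chi N (expi kappa) phi theta =
    Q phi - (2 ^ (1 - N%:Z) * (cos (N%:R * theta))%:C)%:P
    - (2 ^ (1 - N%:Z) * expi (N%:R * phi) * (cos kappa)%:C)%:P.
  rewrite chi_formula // /Q !sub1C !mulrBr !mulr1 !polyCB; ring.
have iN : 'i%C ^+ N = expi (N%:R * (pi / 2)) :> R[i] by rewrite -expi_pihalf expiX.
exists Q; split=> [phi|].
  (* [Q phi] differs from a characteristic polynomial of degree [N > 0] by a constant. *)
  rewrite /Q -addrA -polyCD monicE lead_coefDl -?monicE ?char_poly_monic //.
  rewrite size_char_poly; apply: leq_ltn_trans (size_polyC_leq1 _) _.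
  by rewrite ltnS.
split; first exact: chiQ.
split; first by move=> *; apply: chi_formula.
split=> [phi m m' z|].
  (* [N] times the angle is a multiple of [2 pi], so each polynomial equals the one at angle 0. *)
  have chi2pi (p : int) : char_poly (periodicA N phi (2 * pi / N%:R * p%:~R)) = chi N 1 phi 0.
    rewrite -[LHS]/(chi N 1 _ _) -{1}expi0 chi_formula // cos0 subrr mulr0 addr0.
    rewrite mulrA mulrCA mulfV // mulr1.
    have -> : cos (2 * pi * p%:~R) = 1 :> R.
      case: p => p; first by have [] := expi_2pi R p.
      by rewrite NegzE mulrNz mulrN cosN; have [] := expi_2pi R p.+1.
    by rewrite subrr mulr0 addr0.
  by rewrite !chi2pi.
split=> [evenN|oddN].
  have [m NE] : exists m, N = m.*2 by exists N./2; rewrite even_halfK.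
  have piE : N%:R * (pi / 2) = m%:R * pi :> R by rewrite NE -muln2 natrM; field.
  rewrite iN chi_formula // piE -expiX expi_pi.
  have [-> _] := cos_sin_natpi R m.
  (* With [s = (-1)^m], the corrections sum to a multiple of [(1 - s) + s (1 - s) = 1 - s^2 = 0]. *)
  rewrite -addrA -polyCD -mulrA -mulrDr -[X in _ * (X + _)]mul1r -mulrDl sub1C.
  rewrite rmorphXn rmorphN rmorph1 [(1 + _) * _]mulrC -subr_sqr expr1n sqrr_sign.
  by rewrite subrr mulr0 addr0.
(* Here [kappa = N theta = N pi / 2], so a single vanishing cosine removes both corrections. *)
rewrite iN chiQ; suff -> : cos (N%:R * (pi / 2)) = 0 :> R by rewrite !mulr0 !subr0.
rewrite -(odd_double_half N) oddN natrD mulrDl mul1r -muln2 natrM addrC.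
have -> : N./2%:R * 2 * (pi / 2) = N./2%:R * pi :> R by field.
rewrite cosD cos_pihalf sin_pihalf mulr0 mulr1 sub0r.
by have [_ ->] := cos_sin_natpi R N./2; rewrite oppr0.
Qed.
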